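(* Let $\mathcal{L}_n$ denote the lexicographically least binary de Bruijn sequence of order $n$, and let $\operatorname{disc}(\mathcal{L}_n)$ be its discrepancy. Then $\operatorname{disc}(\mathcal{L}_n) = \Theta(2^n \log n / n)$ as $n \to \infty$; that is, there exist constants $c, C > 0$ and $n_0$ such that for all $n \geq n_0$, $$c\,\frac{2^n \log n}{n} \;\leq\; \operatorname{disc}(\mathcal{L}_n) \;\leq\; C\,\frac{2^n \log n}{n}.$$
   Context: A binary de Bruijn sequence of order $n$ is a word $a_1 \cdots a_{2^n}$ over the alphabet $\{0,1\}$ that contains every binary word of length $n$ exactly once as a contiguous subword when the indices are interpreted cyclically. $\mathcal{L}_n$ is the lexicographically least (with $0<1$) such word. Equivalently, as is well known and used as the description of $\mathcal{L}_n$ in the paper, $\mathcal{L}_n$ is the concatenation, in lexicographic order, of all binary Lyndon words whose length divides $n$. Here two words are conjugate if they have the form $xy$ and $yx$ (cyclic rotations of each other); a word $w$ is aperiodic if whenever $w = xy$ with $x,y$ nonempty, $w \neq yx$; and a Lyndon word is an aperiodic word that is the lexicographically least element of its conjugacy class. For a word $w \in \{0,1\}^*$, write $w_k$ for its $k$-th symbol from left to right, starting with index $0$. The discrepancy of $w$ is $$\operatorname{disc}(w) = \max_M \left| \sum_{k=0}^{M} (-1)^{w_k} \right|,$$ where $M$ ranges over $0 \leq M < |w|$, with $|w|$ the length of $w$; i.e., it is the maximum absolute difference between the number of zeros and the number of ones in an initial segment of $w$. *)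

(* Defs.v *)
From mathcomp Require Import all_boot all_order all_algebra.

Set Implicit Arguments.
Unset Strict Implicit.
Unset Printing Implicit Defensive.

Import Order.TTheory GRing.Theory Num.Theory.

Local Open Scope nat_scope.

(* Binary words are [seq bool], with [false] for 0 and [true] for 1.
   [take n (rot i w)] is the length-[n] factor of [w] read cyclically from
   position [i]; it never wraps around twice since [n < 2 ^ n]. *)
Definition is_de_bruijn (n : nat) (w : seq bool) : bool :=
  (size w == 2 ^ n) &&
  [forall u : n.-tuple bool,
    #|[set i : 'I_(2 ^ n) | take n (rot i w) == u]| == 1].

(* [seqlexi bool] carries the lexicographic order induced by
   [false < true]. *)
Definition is_lex_least_de_bruijn (n : nat) (w : seq bool) : bool :=
  is_de_bruijn n w &&
  [forall v : (2 ^ n).-tuple bool,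
    is_de_bruijn n v ==> ((w : seqlexi bool) <= (tval v : seqlexi bool))%O].

(* The default [[::]] is never reached: de Bruijn words of every order exist,
   and the lexicographically least one is unique. *)
Definition lex_least_de_bruijn (n : nat) : seq bool :=
  if [pick w : (2 ^ n).-tuple bool | is_lex_least_de_bruijn n w] is Some w
  then tval w else [::].

Definition disc (w : seq bool) : nat :=
  \max_(M < size w) absz (\sum_(0 <= k < M.+1) (-1) ^+ nth false w k)%R.

(* Main.v *)
Require Import Defs.
From mathcomp Require Import all_boot all_order all_algebra.
From mathcomp Require Import reals exp.
From mathcomp Require Import zify ring lra.

(** Write [n = m + 1] and view the words of length [n] as the edges of the de
    Bruijn graph, whose vertices are the words of length [m].

    The least de Bruijn word is greedy.  Put [1^m] in front and append letter
    after letter, always a [0] unless this repeats a window of length [n].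
    The result is a de Bruijn word, and a smaller one would have to repeat a
    window ([de_bruijn_not_below_greedy]).

    The windows come necklace by necklace.  For a word [p] of length at most
    [n], call a word [below p] if one of its rotations is lexicographically
    smaller than [p].  This set is closed under rotation and under turning a
    [1] into a [0].  If [p 1...1] is not in it, then the greedy sequence first
    runs through the set, together with the few edges on the way from [1^m] to
    [p], before it takes any other edge ([greedy_fills_initial]).  Hence for
    every [M] there is a necklace [t] such that the first [M] windows are the
    words [below t], up to [O(n)] exceptions ([word_sum_pivots]).

    The prefix sums count pivotal words.  The sum of the first [M] signs is
    the sum of the signs of the last letters of the first [M] windows.  Over
    the words [below t], the contributions of [x0] and [x1] cancel unless only
    [x0] is [below t] ([pivots]).  So up to [O(n)] the discrepancy is the
    largest number of pivotal [x] over all [t].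

    Let [t] begin with exactly [k] zeros.  If lowering the last letter of [x1]
    creates a rotation smaller than [t], then [x] is determined by the position
    of this letter in the first [k] letters of the rotation, which are zeros,
    and by a word of length [n - k] without [k + 1] consecutive zeros, or else
    by a longer prefix of [t] and a shorter word of that kind ([pivots_le]).  At most a
    proportion [O(2^k / n)] of all words are without [k + 1] consecutive zeros
    ([avoiders_decay]).  So there are [O(k 2^n / n)] pivotal words if
    [2^k < n], and trivially [O(k 2^(n-k))] of them if [2^k >= n]; both are
    [O(2^n log n / n)].  The order is reached by [p = 0^k 1] with
    [n < 2^k <= 2n]: then at least half of the words of the relevant length have no run
    of [k + 1] zeros ([avoiders_half]), and each of them gives [k + 1] pivotal
    words ([pivots_ge]). *)

Import Order.TTheory GRing.Theory Num.Theory.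

Set Implicit Arguments.
Unset Strict Implicit.
Unset Printing Implicit Defensive.

Local Open Scope nat_scope.

(** * Words of a given length *)

Fixpoint words (n : nat) : seq (seq bool) :=
  if n is n'.+1 then map (cons false) (words n') ++ map (cons true) (words n')
  else [:: [::]].

Lemma mem_words n w : (w \in words n) = (size w == n).
Proof.
elim: n w => [|n IHn] w /=; first by case: w.
have inj b : injective (@cons bool b) by move=> ? ? [].
rewrite mem_cat; case: w => [|b w] /=.
  by apply/negP => /orP[] /mapP[].
rewrite eqSS -IHn; case: b; rewrite (mem_map (inj _)).
  by apply/orP/idP => [[/mapP[]|]//|->]; right.
by apply/orP/idP => [[//|/mapP[]//]|->]; left.
Qed.

Lemma words_uniq n : uniq (words n).
Proof.
elim: n => //= n IHn; rewrite cat_uniq !map_inj_uniq ?IHn; try by move=> ? ? [].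
by rewrite /= andbT; apply/hasPn => _ /mapP[w _ ->]; apply/mapP => -[].
Qed.

Lemma size_words n : size (words n) = 2 ^ n.
Proof. by elim: n => //= n IHn; rewrite size_cat !size_map IHn expnS mul2n addnn. Qed.

(** [words] branches on the first letter, but the sign of a window is read at
    its last one. *)
Lemma perm_words_rcons n :
  perm_eq (words n.+1)
    (map (rcons^~ false) (words n) ++ map (rcons^~ true) (words n)).
Proof.
have inj b : injective (rcons^~ b : seq bool -> seq bool).
  by move=> ? ? /rcons_inj[].
apply: uniq_perm; first exact: words_uniq.
  rewrite cat_uniq !(map_inj_uniq (inj _)) words_uniq andbT /=.
  by apply/hasPn => _ /mapP[w _ ->]; apply/mapP => -[v _ /rcons_inj[]].
move=> w; rewrite mem_words mem_cat; case/lastP: w => [|w b].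
  by apply/esym/negP => /orP[] /mapP[[|? ?]].
rewrite size_rcons eqSS -mem_words; case: b; rewrite (mem_map (inj _)).
  by apply/idP/orP => [->|[/mapP[v _ /rcons_inj[]]|]//]; right.
by apply/idP/orP => [->|[//|/mapP[v _ /rcons_inj[]]//]]; left.
Qed.

(** * The greedy sequence *)

Definition factor (f : nat -> bool) (i l : nat) : seq bool :=
  mkseq (fun r => f (i + r)) l.

Arguments factor : simpl never.

Lemma size_factor f i l : size (factor f i l) = l.
Proof. exact: size_mkseq. Qed.

Lemma nth_factor f i l r : r < l -> nth false (factor f i l) r = f (i + r).
Proof. exact: nth_mkseq. Qed.

Lemma factorSr f i l : factor f i l.+1 = rcons (factor f i l) (f (i + l)).
Proof. by rewrite /factor mkseqS. Qed.

Lemma factorSl f i l : factor f i l.+1 = f i :: factor f i.+1 l.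
Proof.
apply: (@eq_from_nth _ false) => [|r]; rewrite size_factor /=.
  by rewrite size_factor.
by case: r => [|r] ltr; rewrite nth_factor ?addn0 //= nth_factor ?addSnnS.
Qed.

Lemma drop_factor f i j l : drop j (factor f i l) = factor f (i + j) (l - j).
Proof.
apply: (@eq_from_nth _ false); rewrite ?size_drop ?size_factor // => r ltr.
by rewrite nth_drop !nth_factor ?addnA //; lia.
Qed.

Lemma take_factor f i j l : j <= l -> take j (factor f i l) = factor f i j.
Proof.
move=> lejl; apply: (@eq_from_nth _ false) => [|r].
  by rewrite size_takel ?size_factor.
by rewrite size_takel ?size_factor // => ltr; rewrite nth_take // !nth_factor //; lia.
Qed.

(** The prefer-zero rule: among the two windows that continue the current
    vertex, the one that ends in [0] is taken first. *)
Definition greedy (m : nat) (f : nat -> bool) : Prop :=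
  forall i, f (i + m) =
    (rcons (factor f i m) false \in mkseq (factor f ^~ m.+1) i).

(** The rule refers to all earlier windows, so the sequence is built together
    with its history and then read off letter by letter. *)
Fixpoint greedy_prefix (m i : nat) : seq bool :=
  if i is i'.+1 then
    let s := greedy_prefix m i' in
    rcons s (rcons (drop i' s) false
             \in [seq take m.+1 (drop j s) | j <- iota 0 i'])
  else nseq m true.

Definition greedy_letter (m k : nat) : bool :=
  nth false (greedy_prefix m k.+1) k.

Lemma greedy_prefixE m i :
  greedy_prefix m i = factor (greedy_letter m) 0 (m + i).
Proof.
have sz j : size (greedy_prefix m j) = m + j.
  by elim: j => [|j IHj] /=; rewrite ?size_nseq ?addn0 // size_rcons IHj addnS.
have nthE j d k : k < m + j ->
    nth false (greedy_prefix m (j + d)) k = nth false (greedy_prefix m j) k.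
  move=> ltk; elim: d => [|d IHd]; rewrite ?addn0 // addnS /= nth_rcons sz.
  by rewrite IHd; case: ifP => //; lia.
apply: (@eq_from_nth _ false) => [|k]; rewrite sz ?size_factor // => ltk.
rewrite nth_factor // add0n /greedy_letter.
have [leik|ltki] := leqP i k.+1.
  by rewrite -(subnKC leik) nthE // -{2}(subnKC leik).
by rewrite -(subnKC (ltnW ltki)) nthE //; lia.
Qed.

Lemma greedy_letter_greedy m : greedy m (greedy_letter m).
Proof.
move=> i; have := greedy_prefixE m i.+1.
rewrite addnS factorSr /= greedy_prefixE add0n [i + m]addnC => /rcons_inj[<-].
rewrite drop_factor add0n addnK; congr (_ \in _).
apply/eq_in_map => j; rewrite mem_iota => /andP[_ ltj].
by rewrite drop_factor add0n take_factor //; lia.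
Qed.

Lemma greedy_letter_ones m k : k < m -> greedy_letter m k.
Proof.
move=> ltk; have := greedy_prefixE m 0; rewrite /= addn0 => /(congr1 (nth false ^~ k)).
by rewrite nth_nseq ltk nth_factor // add0n.
Qed.

(** Let a set [S] of words of length [m + 1], seen as the edges of a graph
    whose vertices are the words of length [m], leave as often as it enters
    every vertex, up to a path from the start of the greedy sequence to [z],
    and let it contain [x0] with every [x1].  As long as an edge of [S] out of
    the current vertex is unused, the greedy rule takes one; by counting, all
    of them are used up only at [z].  At that moment the vertices which still
    have an unused exit are closed under following the last exit ([x1] if it
    is in [S], else [x0]), so the last hypothesis leaves none: the windows
    seen so far are exactly [S]. *)
Lemma greedy_fills m f (S : pred (seq bool)) z :
    greedy m f ->
    (forall e, S e -> size e = m.+1) ->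
    (forall x, size x = m ->
       S (false :: x) + S (true :: x) + (x == factor f 0 m) =
       S (rcons x false) + S (rcons x true) + (x == z)) ->
    (forall x, S (rcons x true) -> S (rcons x false)) ->
    (forall U : pred (seq bool),
       (forall x, U x -> [/\ size x = m, x != z, S (rcons x false) &
                             U (behead (rcons x (S (rcons x true))))]) ->
       forall x, ~~ U x) ->
  exists T, [/\ uniq (mkseq (factor f ^~ m.+1) T), factor f T m = z &
    forall e, (e \in mkseq (factor f ^~ m.+1) T) = S e].
Proof.
have arith (A B C a b s : nat) :
    b <= B -> a <= A -> A + B + s = C -> a + b + s = C + 1 -> false by lia.
have arith' (A B a b s D d t : nat) : a + b < A + B ->
    A + B + s = D + t -> a + b + s = d + t -> d < D by lia.
have bool4 (c c' d d' : bool) : c + d < c' + d' -> c' && ~~ c || d' && ~~ d.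
  by case: c c' d d' => [] [] [] [].
move=> gf szS bal prio conn.
pose W := factor f ^~ m.+1.
pose good T := uniq (mkseq W T) && all S (mkseq W T).
have good0 : exists T, good T by exists 0.
have goodb T : good T -> T <= 2 ^ m.+1.
  case/andP=> uW /allP SW; rewrite -size_words -[T in T <= _](size_mkseq W).
  by apply: uniq_leq_size uW _ => e /SW /szS sz; rewrite mem_words sz.
case: (ex_maxnP good0 goodb) => T /andP[uW /allP SW] maxT.
exists T; rewrite -/W.
pose used e := e \in mkseq W T.
have WE i : W i = rcons (factor f i m) (f (i + m)) by exact: factorSr.
have occ e : used e = \sum_(i < T) (W i == e) :> nat.
  rewrite /used -(count_uniq_mem e uW) /mkseq count_map -sum1_count.
  by rewrite -[T in iota 0 T]subn0 big_mkcond /= big_mkord; apply: eq_bigr => i _; case: eqP.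
have outE x : used (rcons x false) + used (rcons x true) =
              \sum_(i < T) (factor f i m == x).
  rewrite !occ -big_split; apply: eq_bigr => i _ /=; rewrite WE !eqseq_rcons.
  by case: (f _) => /=; case: eqP.
have inE x : used (false :: x) + used (true :: x) =
              \sum_(i < T) (factor f i.+1 m == x).
  rewrite !occ -big_split; apply: eq_bigr => i _ /=; rewrite /W factorSl !eqseq_cons.
  by case: (f _) => /=; case: eqP.
have flow x : used (false :: x) + used (true :: x) + (x == factor f 0 m) =
              used (rcons x false) + used (rcons x true) + (x == factor f T m).
  rewrite inE outE [x == _]eq_sym [x == factor f T m]eq_sym.
  have <- := @big_ord_recr nat 0 addn T (fun i => (factor f i m == x) : nat).
  by rewrite big_ord_recl /= addnC.
have usedS e : used e -> S e by exact: SW.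
have usedSn e : used e <= S e by case: (boolP (used e)) => [/usedS->|].
set x := factor f T m.
have bT : f (T + m) = used (rcons x false) by exact: gf.
have stuck : used (W T) || ~~ S (W T).
  rewrite -[_ || _]negbK; apply/negP; rewrite negb_or negbK => /andP[nuT ST].
  suff /maxT : good T.+1 by rewrite ltnn.
  rewrite /good mkseqS rcons_uniq nuT uW /= all_rcons ST; exact/allP.
have [sat0 sat1] : used (rcons x false) = S (rcons x false) /\
                   used (rcons x true) = S (rcons x true).
  move: stuck; rewrite WE -/x bT.
  have [u0|nu0] := boolP (used (rcons x false)).
    by rewrite (usedS _ u0) => /orP[u1|/negbTE nS1]; split=> //;
      [rewrite u1 usedS | apply/idP/idP=> [/usedS//|]; rewrite nS1].
  rewrite (negbTE nu0) /= => /negbTE nS0; split=> //.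
  by apply/idP/idP => [/usedS//|/prio]; rewrite nS0.
have xz : x = z.
  apply/eqP; have := flow x; have := bal x (size_factor _ _ _).
  rewrite sat0 sat1 eqxx.
  have := usedSn (false :: x); have := usedSn (true :: x).
  case: (x == z) => //=; rewrite addn0; exact: arith.
pose U y := (size y == m) &&
   ((S (rcons y false) && ~~ used (rcons y false)) ||
    (S (rcons y true) && ~~ used (rcons y true))).
have noU : forall y, ~~ U y.
  apply: conn => y /andP[/eqP szy Uy].
  have S0 : S (rcons y false) by case/orP: Uy => /andP[// /prio].
  pose e := rcons y (S (rcons y true)); rewrite -/e.
  have /andP[Se nue] : S e && ~~ used e.
    rewrite /e; case S1 : (S (rcons y true)); last by rewrite S0; move: Uy; rewrite S1 orbF S0.
    rewrite S1 /=; apply/negP => /mapP[j]; rewrite mem_iota => /andP[_ ltj].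
    rewrite WE => /rcons_inj[yE /esym]; rewrite gf -yE => /mapP[j' j'lt u0].
    move: Uy; rewrite S1 /= S0 /= => /orP[]/negP; apply.
      apply/mapP; exists j' => //; move: j'lt; rewrite !mem_iota /=; lia.
    by apply/mapP; exists j; rewrite ?mem_iota // WE -yE gf -yE u0; congr rcons; apply/esym/mapP; exists j'.
  split=> //.
    by apply: contraTneq Uy => ->; rewrite -xz -sat0 -sat1 !andbN.
  have sze : size e = m.+1 by rewrite size_rcons szy.
  case eE : e sze => [|hd y'] //= [szy'].
  rewrite /U szy' eqxx /=.
  have flow' := flow y'; rewrite -/x xz in flow'.
  have := arith' _ _ _ _ _ _ _ _ _ (bal y' szy') flow'.
  have := usedSn (false :: y'); have := usedSn (true :: y').
  move: Se nue; rewrite eE; case: hd eE => _ -> /negbTE->.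
    by rewrite addn0 addn1 ltnS => _ le0 /(_ le0) /bool4.
  by rewrite add0n add1n ltnS => le1 _ /(_ le1) /bool4.
split=> // e; apply/idP/idP => [/usedS//|Se].
have := szS e Se; case/lastP: e Se => // y b Sb; rewrite size_rcons => -[szy].
have := noU y; rewrite /U szy eqxx /= negb_or !negb_and !negbK => /andP[].
by case: b Sb => -> //= _; rewrite orbF.
Qed.

(** * Words with a rotation below a given prefix *)

(** Strict lexicographic order, except that a word and its prefixes are
    incomparable: [p] may be shorter than [u] and stands for all of its
    extensions. *)
Fixpoint lts (u p : seq bool) : bool :=
  match u, p with
  | a :: u', b :: p' => if a == b then lts u' p' else b
  | _, _ => false
  end.

Lemma lts_splitP u p :
  reflect (exists c f g, u = c ++ false :: f /\ p = c ++ true :: g) (lts u p).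
Proof.
apply: (iffP idP) => [|[c [f [g [-> ->]]]]]; last by elim: c => //= b c ->; rewrite eqxx.
elim: u p => [|a u IHu] [|b p] //=; case: eqP => [->|ab] H.
  by have [c [f [g [-> ->]]]] := IHu _ H; exists (b :: c), f, g.
by case: a b ab H => [] [] // _ _; exists [::], u, p.
Qed.

Lemma lts_mono u u' p : all2 implb u' u -> lts u p -> lts u' p.
Proof.
elim: u u' p => [|a u IHu] [|a' u'] [|b p] //= /andP[a'a u'u].
by case: a' a b a'a => [] [] [] //= _; exact: IHu.
Qed.

Definition some_rot (P : pred (seq bool)) (u : seq bool) : bool :=
  has (fun j => P (rot j u)) (iota 0 (size u).+1).

Lemma some_rotP (P : pred (seq bool)) u :
  reflect (exists v w, u = v ++ w /\ P (w ++ v)) (some_rot P u).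
Proof.
apply: (iffP hasP) => [[j _ Hj]|[v [w [-> H]]]].
  by exists (take j u), (drop j u); rewrite cat_take_drop.
exists (size v); last by rewrite rot_size_cat.
by rewrite mem_iota size_cat ltnS leq_addr.
Qed.

Lemma some_rot_self (P : pred (seq bool)) u : P u -> some_rot P u.
Proof. by move=> Pu; apply/some_rotP; exists [::], u; rewrite cats0. Qed.

Lemma some_rot_catC P v w : some_rot P (v ++ w) = some_rot P (w ++ v).
Proof.
suff imp a b : some_rot P (a ++ b) -> some_rot P (b ++ a).
  by apply/idP/idP; apply: imp.
case/some_rotP=> c [d [abE H]]; apply/some_rotP.
have [leca|ltac] := leqP (size c) (size a).
  exists (b ++ c), (drop (size c) a).
  have aE : a = c ++ drop (size c) a.
    by rewrite -{1}(cat_take_drop (size c) a) -(takel_cat b leca) abE take_size_cat.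
  have dE : d = drop (size c) a ++ b.
    move: abE; rewrite {1}aE -catA => /eqP.
    by rewrite eqseq_cat // eqxx => /andP[_ /eqP->].
  by rewrite -catA -aE catA -dE.
exists (drop (size a) c), (d ++ a).
have cE : c = a ++ drop (size a) c.
  by rewrite -{1}(cat_take_drop (size a) c) -(takel_cat d (ltnW ltac)) -abE take_size_cat.
have bE : b = drop (size a) c ++ d.
  by move: abE; rewrite {1}cE -catA => /eqP; rewrite eqseq_cat // => /andP[_ /eqP].
by rewrite bE -!catA -cE.
Qed.

Definition below (p : seq bool) : pred (seq bool) := some_rot (lts ^~ p).

Lemma belowP p u :
  reflect (exists v w, u = v ++ w /\ lts (w ++ v) p) (below p u).
Proof. exact: some_rotP. Qed.

Lemma below_catC p v w : below p (v ++ w) = below p (w ++ v).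
Proof. exact: some_rot_catC. Qed.

Lemma below_rcons p x b : below p (rcons x b) = below p (b :: x).
Proof. by rewrite -cats1 below_catC. Qed.

Lemma all2_cat T (r : rel T) s1 s2 t1 t2 : size s1 = size t1 ->
  all2 r (s1 ++ s2) (t1 ++ t2) = all2 r s1 t1 && all2 r s2 t2.
Proof.
by elim: s1 t1 => [|x s1 IHs] [|y t1] //= [/IHs->]; rewrite andbA.
Qed.

Lemma below_mono p u u' : all2 implb u' u -> below p u -> below p u'.
Proof.
move=> u'u /belowP[v [w [uE H]]]; apply/belowP.
have szu : size u' = size v + size w by rewrite -size_cat -uE; move: u'u; rewrite all2E => /andP[/eqP].
exists (take (size v) u'), (drop (size v) u'); split; first by rewrite cat_take_drop.
have szt : size (take (size v) u') = size v by rewrite size_takel ?szu ?leq_addr.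
apply: lts_mono H; move: u'u; rewrite uE -{1}(cat_take_drop (size v) u').
by rewrite !all2_cat ?size_drop ?szu ?addKn // andbC.
Qed.

Lemma all2_implb_refl u : all2 implb u u.
Proof. by elim: u => //= -[]. Qed.

(** The monotonicity that makes [x0] available whenever [x1] is. *)
Lemma below_lower p v w : below p (v ++ true :: w) -> below p (v ++ false :: w).
Proof. by apply: below_mono; rewrite all2_cat //= !all2_implb_refl. Qed.

(** Being [below p] is monotone, so its negation is preserved when letters are
    raised; here, the letters at the end. *)
Lemma below_raise p v w :
  ~~ below p (v ++ w) -> ~~ below p (v ++ nseq (size w) true).
Proof.
apply: contra; apply: below_mono; rewrite all2_cat // all2_implb_refl /=.
by elim: w => //= -[].
Qed.

(** * Initial segments of the greedy sequence *)

(** The vertices that a path from [1^m] runs through when the letters of [p]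
    are shifted in one after the other. *)
Definition entry (m : nat) (p : seq bool) (i : nat) : seq bool :=
  nseq (m - i) true ++ take i p.

Definition entry_edges (m : nat) (p : seq bool) : seq (seq bool) :=
  [seq true :: entry m p i.+1 | i <- iota 0 (size p).-1].

(** The words [below p] alone are rotation closed and so form closed walks.
    The entry edges make up for the path from the start [1^m] to the vertex at
    which the first edge outside this set is taken. *)
Definition initial (m : nat) (p e : seq bool) : bool :=
  (size e == m.+1) && (below p e || (e \in entry_edges m p)).

Lemma size_entry m p i : i <= m -> i <= size p -> size (entry m p i) = m.
Proof. by move=> leim leip; rewrite size_cat size_nseq size_takel // subnK. Qed.

Lemma entry_step m p i : i < m -> i < size p ->
  true :: entry m p i.+1 = rcons (entry m p i) (nth false p i).
Proof.
move=> ltim ltip; rewrite /entry rcons_cat -take_nth //.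
by have -> : m - i = (m - i.+1).+1 by lia.
Qed.

Lemma index_entry m p i :
  head false p = false -> index false (entry m p i) = m - i.
Proof.
move=> p0; rewrite /entry index_cat mem_nseq andbF size_nseq.
by case: p p0 i => [|b p] /= p0 [|i] //=; rewrite ?p0 /= ?addn0.
Qed.

Lemma entry_inj m p i j : head false p = false -> i <= m -> j <= m ->
  entry m p i = entry m p j -> i = j.
Proof.
move=> p0 leim lejm /(congr1 (index false)); rewrite !index_entry //; lia.
Qed.

Lemma entry_edges_uniq m p :
  (1 < size p -> head false p = false) -> size p <= m.+1 ->
  uniq (entry_edges m p).
Proof.
case: (leqP (size p) 1) => [le1|lt1] p0 lep.
  by rewrite /entry_edges; case: (size p) le1 => [|[]].
rewrite map_inj_in_uniq ?iota_uniq // => i j; rewrite !mem_iota /= => lti ltj.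
by case=> /entry_inj E; have := E (p0 isT); lia.
Qed.

Lemma entry_edges_rcons m p : size p <= m.+1 ->
  entry_edges m p =
  [seq rcons (entry m p i) (nth false p i) | i <- iota 0 (size p).-1].
Proof.
move=> lep; apply/eq_in_map => i; rewrite mem_iota => /andP[_ lti].
by apply: entry_step; lia.
Qed.

Lemma entry_notin_below m p i :
  size p <= m.+1 -> ~~ below p (p ++ nseq (m.+1 - size p) true) ->
  i <= size p -> ~~ below p (nseq (m.+1 - i) true ++ take i p).
Proof.
move=> lep np leip; rewrite below_catC.
have -> : nseq (m.+1 - i) true =
          nseq (size (drop i p ++ nseq (m.+1 - size p) true)) true.
  by rewrite size_cat size_drop size_nseq; congr nseq; lia.
by apply: below_raise; rewrite catA cat_take_drop.
Qed.

Lemma entry_edge_initial m p i : size p <= m.+1 -> i < (size p).-1 ->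
  initial m p (true :: entry m p i.+1).
Proof.
move=> lep lti; rewrite /initial /= size_entry ?eqxx; try lia.
by apply/orP; right; apply/mapP; exists i; rewrite ?mem_iota.
Qed.

(** The graph condition of [greedy_fills] holds for the following reason.  The
    entry edges lead to the final vertex.  On a walk of last exits that avoids
    it, all edges are [below p]; the number of ones cannot decrease, as the
    rotated edge is always available, so from its maximum on the walk just
    rotates one word.  Rotate it so that it becomes [c 0 g] with
    [p = c 1 h].  If there is a [0] in [g], turning it into a [1] leaves the
    word [below p], so the last exit would be another one.  Otherwise
    [g = 1...1], and the walk visits the vertex [g c], which lies on the entry
    path. *)
Lemma greedy_fills_initial m f p :
    greedy m f -> factor f 0 m = nseq m true ->
    0 < size p <= m.+1 -> (1 < size p -> head false p = false) ->
    ~~ below p (p ++ nseq (m.+1 - size p) true) ->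
  exists T, [/\ uniq (mkseq (factor f ^~ m.+1) T),
    factor f T m = entry m p (size p).-1 &
    forall e, (e \in mkseq (factor f ^~ m.+1) T) = initial m p e].
Proof.
move=> gf f0 /andP[p_gt0 lep] p0 np.
pose S := initial m p; pose L := (size p).-1; pose v := entry m p.
have ltLp : L < size p by rewrite /L prednK.
have leLm : L <= m by rewrite -ltnS -/L; apply: leq_trans ltLp lep.
have szv i : i <= L -> size (v i) = m.
  by move=> leiL; rewrite size_entry //; lia.
have nbv i : i < L -> ~~ below p (true :: v i.+1).
  move=> ltiL; have := @entry_notin_below m p i.+1 lep np.
  by rewrite subSn; [apply; lia|lia].
have pathn e : (e \in entry_edges m p) = count_mem e (entry_edges m p) :> nat.
  by rewrite count_uniq_mem ?entry_edges_uniq.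
have Sn e : size e = m.+1 -> S e = below p e + (e \in entry_edges m p) :> nat.
  move=> sze; rewrite /S /initial sze eqxx /=.
  have [/mapP[i]|_] := boolP (e \in _); last by rewrite orbF addn0.
  by rewrite mem_iota => /andP[_ ltiL] ->; rewrite (negbTE (nbv i ltiL)).
apply: greedy_fills gf _ _ _ _.
- by move=> e /andP[/eqP].
- move=> x szx; rewrite f0 !Sn ?size_rcons /= ?szx // !below_rcons.
  have -> : nseq m true = v 0 by rewrite /v /entry subn0 take0 cats0.
  suff E : (false :: x \in entry_edges m p) + (true :: x \in entry_edges m p)
         + (x == v 0) = (rcons x false \in entry_edges m p)
         + (rcons x true \in entry_edges m p) + (x == v L).
    by move: E; do ![move: (nat_of_bool _) => ?]; clear; lia.
  have -> : (false :: x \in entry_edges m p) + (true :: x \in entry_edges m p)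
      = \sum_(i < L) (v i.+1 == x).
    rewrite !pathn !count_map -[iota 0 _]/(iota 0 L) -[L in iota 0 L]subn0.
    rewrite -!sum1_count !(big_mkcond (fun i => preim _ _ _)) /= !big_mkord.
    rewrite -big_split; apply: eq_bigr => i _ /=.
    by rewrite !eqseq_cons /=; case: eqP.
  have -> : (rcons x false \in entry_edges m p)
      + (rcons x true \in entry_edges m p) = \sum_(i < L) (v i == x).
    rewrite !pathn entry_edges_rcons // !count_map -[L in iota 0 L]subn0.
    rewrite -!sum1_count !(big_mkcond (fun i => preim _ _ _)) /= !big_mkord.
    rewrite -big_split; apply: eq_bigr => i _ /=.
    by rewrite !eqseq_rcons; case: (nth _ _ _); case: eqP.
  rewrite ![x == _]eq_sym.
  have <- := @big_ord_recr nat 0 addn L (fun i => (v i == x) : nat).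
  by rewrite big_ord_recl /= addnC.
- move=> x; rewrite /S /initial !size_rcons => /andP[-> /=] /orP[bx|/mapP[i]].
    by rewrite -cats1 below_lower // cats1 bx.
  rewrite mem_iota /= -/L => ltiL; rewrite entry_step; try lia.
  move=> /rcons_inj[-> pi]; apply/orP; left.
  rewrite /entry rcons_cat below_catC; apply/belowP; exists [::].
  eexists; split; first by rewrite cat0s.
  rewrite cats0 cat_rcons; apply/lts_splitP; exists (take i p).
  exists (nseq (m - i) true), (drop i.+1 p); split=> //.
  by rewrite -[LHS](cat_take_drop i) (drop_nth false) ?pi //; lia.
move=> U HU.
pose e x := rcons x (S (rcons x true)).
have Ustep x : U x -> U (behead (e x)) by case/HU.
have Uv i : i <= L -> ~~ U (v i).
  move=> leiL; rewrite -(subKn leiL); move: (leq_subr i L); rewrite -/L.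
  move: (L - i) => {leiL}{}i; elim: i => [|k IHk] ltkL.
    by rewrite subn0; apply/negP => /HU[_]; rewrite eqxx.
  have ltiL : L - k.+1 < L by lia.
  have iE : (L - k.+1).+1 = L - k by lia.
  have := IHk (ltnW ltkL); apply: contra => Uk; have := Ustep _ Uk; rewrite /e.
  set i := L - k.+1 in ltiL iE Uk *.
  suff -> : S (rcons (v i) true) = nth false p i.
    by rewrite -entry_step /= ?iE //; lia.
  have [pi|pi] := boolP (nth false p i).
    by have := entry_edge_initial lep ltiL; rewrite entry_step ?pi //; lia.
  apply/negbTE; rewrite /S /initial !negb_and negb_or; apply/orP; right.
  apply/andP; split.
    rewrite below_rcons; apply: contra (nbv i ltiL); rewrite entry_step; try lia.
    by rewrite (negbTE pi) below_rcons; have := @below_lower p [::] (v i); apply.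
  rewrite entry_edges_rcons //; apply/mapP => -[j].
  rewrite mem_iota -/L => /andP[_ ltj] /rcons_inj[/entry_inj E pj].
  by move: pi; rewrite (E (p0 _)) -?pj //; lia.
have sze x : U x -> size (e x) = m.+1 by case/HU => szx _ _ _; rewrite size_rcons szx.
have Se x : U x -> S (e x).
  by case/HU => _ _ S0 _; rewrite /e; case S1: (S (rcons x true)).
have Ub x : U x -> below p (e x).
  move=> Ux; have := Se x Ux; rewrite /S /initial => /andP[_ /orP[//|]].
  rewrite entry_edges_rcons // => /mapP[i]; rewrite mem_iota -/L => /andP[_ lti].
  by case/rcons_inj => xE _; move: Ux; rewrite xE (negbTE (Uv i _)) //; exact: ltnW.
have Sb x : size x = m -> below p (rcons x true) -> S (rcons x true).
  by move=> szx bx; rewrite /S /initial size_rcons szx eqxx bx.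
move=> x0; apply/negP => Ux0.
(* [k]: the maximal number of ones on a last exit; [I]: where it is attained *)
pose P k := has (fun x => U x && (count id (e x) == k)) (words m).
have exP : exists k, P k.
  exists (count id (e x0)); apply/hasP; exists x0; last by rewrite Ux0 /=.
  by rewrite mem_words; case/HU: Ux0 => ->.
have ubP k : P k -> k <= m.+1.
  case/hasP=> x _ /andP[Ux /eqP<-]; rewrite -(sze x Ux); exact: count_size.
case: (ex_maxnP exP ubP) => k /hasP[x _ Px] maxk {ubP exP x0 Ux0}.
pose I x := U x && (count id (e x) == k).
have Istep y a w : I y -> e y = a :: w -> I w /\ e w = rcons w a.
  case/andP=> Uy /eqP county ey; have := Ustep y Uy; rewrite -/(e y) ey /= => Uw.
  suff ew : e w = rcons w a.
    by split=> //; rewrite /I Uw ew -county ey -cats1 count_cat /= addn0 addnC eqxx.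
  have szw : size w = m by case/HU: Uw.
  have bw : below p (rcons w a) by rewrite below_rcons -ey Ub.
  rewrite /e; case: a ey bw => ey bw; first by rewrite Sb.
  case S1 : (S (rcons w true)) => //.
  suff /maxk : P k.+1 by rewrite ltnn.
  apply/hasP; exists w; first by rewrite mem_words szw.
  by rewrite Uw /e S1 -county ey -cats1 count_cat /= add0n addn1 eqxx.
have Irot y v1 w1 : I y -> e y = v1 ++ w1 -> exists2 y', I y' & e y' = w1 ++ v1.
  elim: v1 w1 y => [|a v1 IHv] w1 y Iy ey; first by exists y; rewrite ?cats0.
  have [Iw ew] := Istep _ _ _ Iy ey.
  have [|y' Iy' ey'] := IHv (rcons w1 a) _ Iw; first by rewrite ew rcons_cat.
  by exists y'; rewrite // ey' cat_rcons.
have /belowP[v1 [w1 [ex /lts_splitP[c [g [h [wvE pE]]]]]]] : below p (e x).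
  by apply: Ub; case/andP: Px.
have [y Iy ey] := Irot x v1 w1 Px ex; rewrite wvE in ey.
have [f_in|f_notin] := boolP (false \in g).
  case/splitPr: f_in ey => g1 g2 ey.
  have [|y2 Iy2 ey2] := Irot y (c ++ false :: g1) (false :: g2) Iy.
    by rewrite ey -catA.
  have [/andP[Uw _] ew] := Istep _ _ _ Iy2 ey2.
  move/rcons_inj: ew => [/negbT/negP]; apply; apply: Sb; first by case/HU: Uw.
  rewrite -cats1 -catA below_catC; apply/belowP; exists [::]; eexists.
  split; first by rewrite cat0s.
  rewrite cats0 pE; apply/lts_splitP; exists c, (g1 ++ true :: g2), h.
  by split=> //; rewrite -!catA.
have gE : g = nseq (size g) true.
  apply/all_pred1P/allP => b bg; apply/eqP; case: b bg => // bg.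
  by rewrite bg in f_notin.
have [y2 Iy2 ey2] := Irot y c (false :: g) Iy ey.
have [/andP[Uw _] _] := Istep y2 false (g ++ c) Iy2 ey2.
have szcg : size g + size c = m by rewrite -size_cat; case/HU: Uw.
have lecL : size c <= L by rewrite /L pE size_cat /= addnS /= leq_addr.
move: Uw; suff -> : g ++ c = v (size c) by rewrite (negbTE (Uv _ lecL)).
by rewrite /v /entry pE take_size_cat // {1}gE; congr (nseq _ _ ++ _); lia.
Qed.

(** * The greedy sequence is the least de Bruijn word *)

Definition greedy_word (m : nat) : seq bool :=
  factor (greedy_letter m) m (2 ^ m.+1).

Lemma factor_greedy_letter0 m : factor (greedy_letter m) 0 m = nseq m true.
Proof. by have := greedy_prefixE m 0; rewrite /= addn0. Qed.

(** With [p = 1] every word but [1^n] is [below p], and there are no entry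
    edges: the greedy sequence takes all other edges, returns to [1^m] and
    closes up with the edge [1^n]. *)
Lemma greedy_windows m (f := greedy_letter m) :
  perm_eq (mkseq (factor f ^~ m.+1) (2 ^ m.+1)) (words m.+1) /\
  factor f (2 ^ m.+1) m = nseq m true.
Proof.
have gf : greedy m f := @greedy_letter_greedy m.
have b1 e : below [:: true] e = (false \in e).
  apply/belowP/idP => [[v [w [->]]]|/splitPr[v w]].
    by rewrite mem_cat orbC -mem_cat; case: (w ++ v) => [|[] []].
  by exists v, (false :: w).
have [||||T [uW VT WT]] := @greedy_fills_initial m f [:: true] gf.
- exact: factor_greedy_letter0.
- by [].
- by [].
- by rewrite b1 in_cons mem_nseq andbF.
have {}VT : factor f T m = nseq m true by rewrite VT /entry subn0 cats0.
have initE e : initial m [:: true] e = (size e == m.+1) && (false \in e).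
  by rewrite /initial b1 orbF.
have WTE : factor f T m.+1 = nseq m.+1 true.
  rewrite factorSr gf VT WT initE size_rcons size_nseq eqxx mem_rcons mem_head.
  by rewrite -cats1 -(nseqD m 1) addn1.
have pW : perm_eq (mkseq (factor f ^~ m.+1) T.+1) (words m.+1).
  apply: uniq_perm (words_uniq _) _ => [|e].
    by rewrite mkseqS rcons_uniq uW andbT WT initE WTE mem_nseq !andbF.
  rewrite mkseqS mem_rcons in_cons WT initE WTE mem_words.
  have [->|ne] := eqVneq; first by rewrite size_nseq eqxx.
  case: eqP => //= sze; apply/negPn/negP => nf; case/negP: ne; apply/eqP.
  rewrite -sze; apply/all_pred1P/allP => -[] // ef; by rewrite ef in nf.
have TE : T.+1 = 2 ^ m.+1.
  by rewrite -size_words -(perm_size pW) size_mkseq.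
rewrite -TE; split=> //; have := WTE; rewrite factorSl /= => -[_].
by [].
Qed.

(** The letters [1^m] put in front are also the last [m] letters of the word,
    so that its cyclic windows are windows of the sequence. *)
Lemma take_rot_factor f m N i : m < N -> i < N ->
  (forall q, q < m -> f (N + q) = f q) ->
  take m.+1 (rot i (factor f m N)) =
  factor f (if i + m < N then i + m else i + m - N) m.+1.
Proof.
move=> ltmN ltiN per; apply: (@eq_from_nth _ false) => [|k].
  by rewrite size_takel ?size_rot ?size_factor.
rewrite size_takel ?size_rot ?size_factor // => ltk.
rewrite nth_take // nth_factor // /rot nth_cat size_drop size_factor.
case: ltnP => ltki.
  rewrite nth_drop nth_factor; last lia.
  case: ltnP => im; first by congr f; lia.
  rewrite (_ : m + (i + k) = N + (i + m - N + k)); last lia.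
  by rewrite per //; lia.
rewrite nth_take ?nth_factor; try lia.
by case: ltnP => im; [lia|congr f; lia].
Qed.

Lemma is_de_bruijnP n w :
  reflect (size w = 2 ^ n /\
           perm_eq (mkseq (fun i => take n (rot i w)) (2 ^ n)) (words n))
          (is_de_bruijn n w).
Proof.
rewrite /is_de_bruijn; set s := mkseq _ _.
have cardE (u : seq bool) :
    #|[set i : 'I_(2 ^ n) | take n (rot i w) == u]| = count_mem u s.
  rewrite -sum1dep_card -(big_mkord (fun i => take n (rot i w) == u) (fun=> 1)).
  by rewrite sum1_count count_map /index_iota subn0.
apply: (iffP andP) => [[/eqP szw /forallP db]|[-> pw]]; split=> //.
  have count1 u : size u = n -> count_mem u s = 1.
    by move=> szu; have /eqP := db (Tuple (introT eqP szu)); rewrite cardE.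
  have szs u : u \in s -> size u = n.
    case/mapP=> i _ ->; rewrite size_takel // size_rot szw.
    exact: ltnW (ltn_expl _ _).
  apply: uniq_perm (words_uniq _) _ => [|u].
    apply: count_mem_uniq => u; have [us|nus] := boolP (u \in s).
      by rewrite count1 // szs.
    by apply/count_memPn.
  rewrite mem_words; apply/idP/eqP => [/szs//|/count1 c1].
  by rewrite -has_pred1 has_count c1.
apply/forallP => u; rewrite cardE (permP pw) count_uniq_mem ?words_uniq //.
by rewrite mem_words size_tuple eqxx.
Qed.

Lemma de_bruijn_inj n w i j : is_de_bruijn n w -> i < 2 ^ n -> j < 2 ^ n ->
  take n (rot i w) = take n (rot j w) -> i = j.
Proof.
case/is_de_bruijnP => _ /perm_uniq; rewrite words_uniq => /mkseq_uniqP inj.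
exact: inj.
Qed.

Lemma greedy_letter_periodic m q :
  q < m -> greedy_letter m (2 ^ m.+1 + q) = greedy_letter m q.
Proof.
move=> ltqm; rewrite (greedy_letter_ones ltqm).
have [_ /(congr1 (nth false ^~ q))] := greedy_windows m.
by rewrite nth_factor // nth_nseq ltqm.
Qed.

Lemma greedy_word_de_bruijn m : is_de_bruijn m.+1 (greedy_word m).
Proof.
apply/is_de_bruijnP; rewrite size_factor; split=> //.
have [pW _] := greedy_windows m; have ltmN : m < 2 ^ m.+1 by apply: ltnW (ltn_expl _ _).
set s := mkseq _ _.
have subs : {subset words m.+1 <= s}.
  move=> u; rewrite -(perm_mem pW) => /mapP[j]; rewrite mem_iota => /andP[_ ltj] ->.
  apply/mapP; exists (if m <= j then j - m else j + 2 ^ m.+1 - m).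
    by rewrite mem_iota; case: (leqP m j); lia.
  rewrite take_rot_factor //.
  - by congr factor; case: (leqP m j) => lemj; case: ltnP; lia.
  - by case: (leqP m j); lia.
  exact: greedy_letter_periodic.
have szs : size s <= size (words m.+1) by rewrite size_mkseq size_words.
have [_ eqs] := uniq_min_size (words_uniq _) subs szs.
rewrite perm_sym; apply: uniq_perm => //; first exact: words_uniq.
exact: leq_size_uniq (words_uniq _) subs szs.
Qed.

Lemma greedy_start m i : i <= m ->
  factor (greedy_letter m) i m.+1 = nseq (m - i) true ++ nseq i.+1 false.
Proof.
elim/ltn_ind: i => i IHi leim.
have Vi : factor (greedy_letter m) i m = nseq (m - i) true ++ nseq i false.
  case: i IHi leim => [|i] IHi leim.
    by rewrite factor_greedy_letter0 subn0 cats0.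
  have := IHi i (leqnn _) (ltnW leim); rewrite factorSl.
  by rewrite (_ : m - i = (m - i.+1).+1); [case|lia].
have E : rcons (nseq (m - i) true ++ nseq i false) false =
         nseq (m - i) true ++ nseq i.+1 false.
  by rewrite rcons_cat -cats1 -(nseqD i 1) addn1.
rewrite factorSr greedy_letter_greedy Vi E.
suff /negbTE-> : nseq (m - i) true ++ nseq i.+1 false
   \notin mkseq ((factor (greedy_letter m))^~ m.+1) i by [].
apply/mapP => -[j]; rewrite mem_iota add0n => /andP[_ ltji].
rewrite IHi //; last lia.
move/(congr1 (index false)); rewrite !index_cat !mem_nseq !andbF !size_nseq /=.
lia.
Qed.

Lemma lexi_lts (u v : seq bool) : size u = size v ->
  ((u : seqlexi bool) <= (v : seqlexi bool))%O -> u = v \/ lts u v.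
Proof.
elim: u v => [|a u IHu] [|b v] //= => [_ _|[szuv]]; first by left.
rewrite lexi_cons => /andP[leab].
have [<-|neab] := eqVneq a b.
  by rewrite lexx => /(IHu _ szuv) [->|]; [left|right].
by case: a b leab neab => [] [] //= _ _ _; right.
Qed.

Lemma zeros_one_split i c h :
  rcons (nseq i false) true = c ++ true :: h -> c = nseq i false.
Proof.
elim: i c => [|i IHi] [|b c] //=; first by case: c.
by case=> <- /IHi ->.
Qed.

Lemma below_zeros i u : below (rcons (nseq i false) true) u ->
  i < count_mem false u.
Proof.
case/belowP=> v [w [-> /lts_splitP[c [g [h [wvE /zeros_one_split ci]]]]]].
by rewrite count_cat addnC -count_cat wvE ci count_cat count_nseq /= mul1n; lia.
Qed.

Lemma zeros_one_not_below i j (p := rcons (nseq i false) true) :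
  ~~ below p (p ++ nseq j true).
Proof.
apply/negP => /below_zeros.
by rewrite /p -cats1 !count_cat !count_nseq /=; lia.
Qed.

Lemma head_zeros_one i : 1 < size (rcons (nseq i false) true) ->
  head false (rcons (nseq i false) true) = false.
Proof. by case: i. Qed.

(** A de Bruijn word [v] below the greedy one departs from it by putting a
    [0] where the greedy rule, having met this window before, puts a [1]; so
    [v] would contain a window twice.  This is no contradiction as such if
    the first occurrence reaches back into the letters [1^m] put before the
    word, that is, if the window is [1^(m-i) 0^(i+1)].  But by that time all
    words with a cyclic run of [i + 1] zeros are used up, among them the
    window of [v] that consists of its last [m - i] letters and its [i + 1]
    leading zeros. *)
Lemma de_bruijn_not_below_greedy m v :
  is_de_bruijn m.+1 v -> ~~ lts v (greedy_word m).
Proof.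
move=> dbv; apply/negP => /lts_splitP[c [v' [g' [vE gE]]]].
set f := greedy_letter m; set N := 2 ^ m.+1; set M := size c.
have gf : greedy m f by exact: greedy_letter_greedy.
have ltmN : m.+1 < N by exact: ltn_expl.
have szv : size v = N by case/is_de_bruijnP: dbv.
have ltMN : M < N by rewrite -szv vE size_cat /= /M; lia.
have fv k : k < M -> nth false v k = f (m + k).
  move=> ltk; rewrite -(@nth_factor f m N) -/(greedy_word m); last by lia.
  by rewrite vE gE !nth_cat ltk.
have fM : f (M + m) = true.
  rewrite addnC -(@nth_factor f m N) // -/(greedy_word m) gE.
  by rewrite nth_cat ltnn subnn.
have vM : nth false v M = false by rewrite vE nth_cat ltnn subnn.
(* window [i] of the greedy sequence ends at letter [i] of the word *)
have winv i : m <= i < M -> take m.+1 (rot (i - m) v) = factor f i m.+1.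
  case/andP=> lemi ltiM; apply: (@eq_from_nth _ false) => [|k].
    by rewrite size_takel ?size_rot ?szv ?size_factor //; lia.
  rewrite size_takel ?size_rot ?szv; last lia.
  move=> ltk; rewrite nth_take // nth_factor // /rot nth_cat size_drop szv.
  by rewrite ifT ?nth_drop ?fv; [congr f| |]; lia.
have winM : m <= M -> take m.+1 (rot (M - m) v) = rcons (factor f M m) false.
  move=> lemM; apply: (@eq_from_nth _ false) => [|k].
    by rewrite size_takel ?size_rcons ?size_rot ?szv ?size_factor //; lia.
  rewrite size_takel ?size_rot ?szv; last lia.
  move=> ltk; rewrite nth_take // nth_rcons size_factor /rot nth_cat size_drop szv.
  rewrite ifT ?nth_drop; last lia.
  have [ltkm|] := ltnP k m; first by rewrite nth_factor // fv; [congr f|]; lia.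
  by move=> lemk; rewrite (_ : M - m + k = M) ?vM; [case: eqP|]; lia.
have [i ltiM xE] : exists2 i : nat, i < M &
    rcons (factor f M m) false = factor f i m.+1.
  have := gf M; rewrite fM => /esym/mapP[i].
  by rewrite mem_iota => ltiM ->; exists i.
have start k : k <= m -> f (k + m) = false.
  move=> lek; have := greedy_start lek; rewrite factorSr.
  by rewrite -addn1 (nseqD k 1) catA cats1 => /rcons_inj[].
have ltmM : m < M.
  by rewrite ltnNge; apply/negP => /start; rewrite fM.
have [lemi|ltim] := leqP m i.
  suff : i - m = M - m by lia.
  apply: (de_bruijn_inj dbv); rewrite -/N; [lia|lia|].
  by rewrite winM ?winv ?xE ?lemi //; exact: ltnW.
set p := rcons (nseq i false) true.
have szp : size p = i.+1 by rewrite size_rcons size_nseq.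
have nthp k : k < i -> nth false p k = false.
  by move=> ltki; rewrite nth_rcons size_nseq ltki nth_nseq ltki.
have np := zeros_one_not_below i (m.+1 - size p) : ~~ below p _.
have [|||T [uT VT WT]] := @greedy_fills_initial m f p gf _ _ _ np.
- exact: factor_greedy_letter0.
- by rewrite szp; lia.
- exact: head_zeros_one.
have VM : factor f M m = nseq (m - i) true ++ nseq i false.
  have := xE; rewrite greedy_start ?(ltnW ltim) // -addn1 (nseqD i 1) catA cats1.
  by case/rcons_inj.
have leTM : T <= M.
  rewrite leqNgt; apply/negP => ltMT.
  have : initial m p (factor f M m.+1).
    by rewrite -WT; apply/mapP; exists M; rewrite ?mem_iota.
  rewrite factorSr fM VM /initial => /andP[_ /orP[|]].
    rewrite rcons_cat below_catC; apply/negP.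
    by move: np; rewrite szp subSS.
  rewrite entry_edges_rcons ?szp; last lia.
  case/mapP=> k; rewrite mem_iota /= => ltk /rcons_inj[_].
  by rewrite nthp.
set u := drop (N - (m - i)) v ++ nseq i.+1 false.
have szd : size (drop (N - (m - i)) v) = m - i by rewrite size_drop szv; lia.
have take0 k : k <= m.+1 -> take k v = nseq k false.
  move=> lek; apply: (@eq_from_nth _ false) => [|r].
    by rewrite size_takel ?size_nseq ?szv //; lia.
  rewrite size_takel ?szv; last lia.
  move=> ltr; rewrite nth_take // nth_nseq ltr fv; last lia.
  by rewrite addnC start //; lia.
have uE : take m.+1 (rot (N - (m - i)) v) = u.
  rewrite /u /rot take_cat szd ifN; last lia.
  by congr cat; rewrite take_takel ?take0; [congr nseq| |]; lia.
have last1 : nth false v N.-1.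
  apply/negPn/negP => last0; suff : N.-1 = 0 by lia.
  apply: (de_bruijn_inj dbv); rewrite -/N; try lia.
  rewrite rot0 take0 // /rot (drop_nth false) ?szv; last lia.
  rewrite drop_oversize ?szv; last lia.
  by rewrite (negbTE last0) /= take_takel ?take0 //; lia.
have : initial m p u.
  rewrite /initial size_cat szd size_nseq; apply/andP; split; first by apply/eqP; lia.
  apply/orP; left; apply/belowP; do 2!eexists; split; first by [].
  apply/lts_splitP; exists (nseq i false), (drop (N - (m - i)) v), [::].
  by rewrite cats1 -addn1 nseqD -catA.
rewrite -WT => uT'; have {uT'}[k ltkT kE] : exists2 k : nat, k < T & u = factor f k m.+1.
  by case/mapP: uT' => k; rewrite mem_iota => ltkT ->; exists k.
have ltkM : k < M by exact: leq_trans ltkT leTM.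
have [lemk|ltkm] := leqP m k.
  suff : N - (m - i) = k - m by lia.
  apply: (de_bruijn_inj dbv); rewrite -/N; [lia|lia|].
  by rewrite uE winv ?lemk.
have : N - (m - i) = M - m.
  apply: (de_bruijn_inj dbv); rewrite -/N; [lia|lia|].
  rewrite uE winM ?xE ?kE; last exact: ltnW.
  suff -> : k = i by [].
  have nthu r : nth false u r = (r < m - k).
    rewrite kE greedy_start ?(ltnW ltkm) // nth_cat size_nseq.
    by case: ltnP => ltr; rewrite nth_nseq ?ltr //; case: ifP.
  have : nth false u (m - i) = false.
    by rewrite nth_cat szd ltnn subnn.
  have : nth false u (m - i).-1 = true.
    rewrite nth_cat szd ifT; last lia.
    by rewrite nth_drop -[RHS]last1; congr nth; lia.
  by rewrite !nthu; lia.
lia.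
Qed.

Lemma lex_least_de_bruijnE m : lex_least_de_bruijn m.+1 = greedy_word m.
Proof.
have least v : is_de_bruijn m.+1 v ->
    ((v : seqlexi bool) <= (greedy_word m : seqlexi bool))%O -> v = greedy_word m.
  move=> dbv lev; have [|//|] := lexi_lts _ lev.
    by case/is_de_bruijnP: dbv => ->; rewrite size_factor.
  by rewrite (negbTE (de_bruijn_not_below_greedy dbv)).
have szG : size (greedy_word m) == 2 ^ m.+1 by rewrite size_factor.
rewrite /lex_least_de_bruijn; case: pickP => [w /andP[dbw /forallP minw]|].
  by apply: least => //; have := minw (Tuple szG); rewrite /= greedy_word_de_bruijn.
move/(_ (Tuple szG)); rewrite /is_lex_least_de_bruijn /= greedy_word_de_bruijn /=.
move/negP; case; apply/forallP => v; apply/implyP => dbv.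
have /orP[//|/(least _ dbv) vE] :=
  le_total (greedy_word m : seqlexi bool) (tval v : seqlexi bool).
by rewrite vE lexx.
Qed.

(** * Discrepancy and pivotal words *)

(** The influence, in the sense of Boolean functions, of the last letter on
    the monotone property [below p]; by rotation, of any letter. *)
Definition pivots (m : nat) (p : seq bool) : nat :=
  count (fun x => below p (rcons x false) && ~~ below p (rcons x true)) (words m).

Definition last_sign (e : seq bool) : int := ((-1) ^+ last false e)%R.

Lemma sum_last_sign_below m p :
  (\sum_(e <- words m.+1 | below p e) last_sign e = (pivots m p)%:Z)%R.
Proof.
rewrite (perm_big _ (perm_words_rcons m)) /= big_cat !big_map /=.
rewrite !(big_mkcond (fun x => below p _)) -big_split /= /pivots.
rewrite -sum1_count (big_morph Posz PoszD (erefl _)) [RHS]big_mkcond /=; apply: eq_bigr => x _.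
rewrite /last_sign !last_rcons expr0 expr1.
have := @below_lower p x [::]; rewrite !cats1.
by case: below => [->|_] //=; case: below.
Qed.

(** The list [X] collects the exceptions, each of which costs at most one. *)
Lemma sum_last_sign_approx m p (L X : seq (seq bool)) :
    uniq L -> {in L, forall e, size e = m.+1} ->
    (forall e, size e = m.+1 -> below p e -> e \in L) ->
    (forall e, e \in L -> ~~ below p e -> e \in X) ->
  (`|\sum_(e <- L) last_sign e - (pivots m p)%:Z| <= (size X)%:Z)%R.
Proof.
move=> uL szL AL LX; rewrite -sum_last_sign_below (bigID (below p)) /=.
have -> : (\sum_(e <- L | below p e) last_sign e =
           \sum_(e <- words m.+1 | below p e) last_sign e)%R.
  rewrite -big_filter -[RHS]big_filter; apply/perm_big/uniq_perm.
  - exact: filter_uniq.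
  - by rewrite filter_uniq ?words_uniq.
  move=> e; rewrite !mem_filter mem_words; case: (boolP (below p e)) => //= be.
  by apply/idP/eqP => [/szL|/AL]//; apply.
rewrite addrC addrK; apply: le_trans (ler_norm_sum _ _ _) _.
rewrite (eq_bigr (fun=> 1%R)); last first.
  by move=> e _; rewrite /last_sign normrX normrN1 expr1n.
rewrite -(big_morph Posz PoszD (erefl _) _ _ (fun=> 1%N)) sum1_count -size_filter.
rewrite lez_nat; apply: uniq_leq_size; first exact: filter_uniq.
by move=> e; rewrite mem_filter => /andP[nb eL]; apply: LX.
Qed.

Lemma lts_total u v : size u = size v -> u != v -> lts u v || lts v u.
Proof.
elim: u v => [|a u IHu] [|b v] //= [szuv]; rewrite eqseq_cons.
by case: a b => [] [] //=; exact: IHu.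
Qed.

Lemma lts_min n (Q : pred (seq bool)) : has Q (words n) ->
  exists t, [/\ size t = n, Q t & forall u, size u = n -> Q u -> ~~ lts u t].
Proof.
elim: n Q => [|n IHn] Q; first by rewrite /= orbF => Q0; exists [::]; split=> // -[].
rewrite /= has_cat !has_map.
have [|no0 /= has1] := boolP (has (fun x => Q (false :: x)) (words n)).
  move=> /IHn[t [szt Qt mint]] _; exists (false :: t); split=> //=; first by rewrite szt.
  by case=> [|[] u] //= [szu] Qu; exact: mint.
have [t [szt Qt mint]] := IHn _ has1; exists (true :: t); split=> //=; first by rewrite szt.
case=> [|[] u] //= [szu] Qu; first exact: mint.
by case/hasP: no0; exists u; rewrite // mem_words szu.
Qed.

(** As [some_rot P] is rotation invariant, the minimality of [t] bears on all
    rotations of a word at once. *)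
Lemma some_rot_words_min n (P : pred (seq bool)) :
  has (some_rot P) (words n) ->
  exists t, [/\ size t = n, some_rot P t, ~~ below t t &
    forall e, size e = n -> below t e -> ~~ some_rot P e].
Proof.
move=> /lts_min[t [szt Pt mint]].
suff H e : size e = n -> below t e -> ~~ some_rot P e.
  by exists t; split=> //; apply/negP => /(H _ szt); rewrite Pt.
move=> sze /belowP[v [w [eE]]]; apply: contraL => Pe.
apply: mint; last by rewrite some_rot_catC -eE.
by rewrite size_cat addnC -size_cat -eE.
Qed.

Definition word_sum (m M : nat) : int :=
  (\sum_(0 <= k < M) (-1) ^+ nth false (greedy_word m) k)%R.

Lemma word_sumE m M : M <= 2 ^ m.+1 ->
  (word_sum m M = \sum_(e <- mkseq (factor (greedy_letter m) ^~ m.+1) M)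
                    last_sign e)%R.
Proof.
move=> leM; rewrite /word_sum big_map /index_iota subn0 big_seq [RHS]big_seq.
apply: eq_bigr => k; rewrite mem_iota => /andP[_ ltk].
rewrite nth_factor; last lia.
by rewrite /last_sign factorSr last_rcons addnC.
Qed.

Lemma windows_uniq m M : M <= 2 ^ m.+1 ->
  uniq (mkseq (factor (greedy_letter m) ^~ m.+1) M).
Proof.
move=> leM; have [/perm_uniq] := greedy_windows m; rewrite words_uniq.
by move=> + _; rewrite /mkseq -(subnKC leM) iotaD map_cat cat_uniq => /andP[].
Qed.

Lemma windows_subset f n M T : M <= T ->
  {subset mkseq (factor f ^~ n) M <= mkseq (factor f ^~ n) T}.
Proof.
move=> leMT e /mapP[k]; rewrite mem_iota => /andP[_ ltk] ->.
by apply/mapP; exists k; rewrite ?mem_iota //; lia.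
Qed.

Lemma windows_size f n M : {in mkseq (factor f ^~ n) M, forall e, size e = n}.
Proof. by move=> e /mapP[k _ ->]; rewrite size_factor. Qed.

(** The prefix [M] ends when the words [below p] have just been used up; the
    loss of [m] accounts for the entry edges. *)
Lemma pivots_le_word_sum m p :
    0 < size p <= m.+1 -> (1 < size p -> head false p = false) ->
    ~~ below p (p ++ nseq (m.+1 - size p) true) ->
  exists2 M, M <= 2 ^ m.+1 & pivots m p <= absz (word_sum m M) + m.
Proof.
move=> szp p0 np.
have [T [uT _ WT]] := greedy_fills_initial (@greedy_letter_greedy m)
  (factor_greedy_letter0 m) szp p0 np.
have leT : T <= 2 ^ m.+1.
  rewrite -size_words -[T](size_mkseq (factor (greedy_letter m) ^~ m.+1)).
  by apply: uniq_leq_size => // e /windows_size sze; rewrite mem_words sze.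
exists T => //.
have := @sum_last_sign_approx m p _ (entry_edges m p) uT (@windows_size _ _ _).
rewrite -word_sumE // => approx.
have {approx} : (`|word_sum m T - (pivots m p)%:Z| <= (size (entry_edges m p))%:Z)%R.
  apply: approx => e; rewrite WT /initial.
    by move=> -> ->; rewrite eqxx.
  by case/andP=> _ /orP[->|].
rewrite size_map size_iota; case/andP: szp => _; lia.
Qed.

Definition rotations (t : seq bool) := mkseq (fun j => rot j t) (size t).+1.

Lemma mem_rotations t u : some_rot (pred1 t) u -> u \in rotations t.
Proof.
case/some_rotP=> v [w [-> /eqP <-]]; apply/mapP; exists (size w).
  by rewrite mem_iota size_cat ltnS leq_addr.
by rewrite rot_size_cat.
Qed.

(** Let [t] be the least word with a rotation that is not among the first [M]
    windows.  All words [below t] are among them.  If [t'] is the next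
    necklace, then [t] and its rotations are below [t'], so that the first
    [M] windows lie within [initial m t']: apart from the words [below t]
    these are the rotations of [t] and at most [m] words that lead to [t']. *)
Lemma word_sum_pivots m M : M <= 2 ^ m.+1 ->
  exists t, [/\ size t = m.+1, ~~ below t t &
    (`|word_sum m M - (pivots m t)%:Z| <= (2 * m.+1 + 1)%:Z)%R].
Proof.
move=> leM; pose f := greedy_letter m; pose L := mkseq (factor f ^~ m.+1) M.
have uL : uniq L by exact: windows_uniq.
have szL : {in L, forall e, size e = m.+1} by exact: windows_size.
have approx t X : (forall e, size e = m.+1 -> below t e -> e \in L) ->
    (forall e, e \in L -> ~~ below t e -> e \in X) -> size X <= 2 * m.+1 + 1 ->
  (`|word_sum m M - (pivots m t)%:Z| <= (2 * m.+1 + 1)%:Z)%R.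
  move=> AL LX szX; rewrite word_sumE //.
  by apply: le_trans (sum_last_sign_approx uL szL AL LX) _.
have ones e : false \notin e -> e = nseq (size e) true.
  move=> ne; apply/all_pred1P/allP => -[] // be; by rewrite be in ne.
have [hasQ|noQ] := boolP (has (some_rot (fun r => r \notin L)) (words m.+1)); last first.
  have allL e : size e = m.+1 -> e \in L.
    move=> sze; apply/negPn/negP => neL; case/hasP: noQ.
    by exists e; [rewrite mem_words sze|exact: some_rot_self].
  exists (nseq m.+1 true); split; first by rewrite size_nseq.
    apply/belowP => -[v [w [E /lts_splitP[c [g [h [wvE _]]]]]]].
    have : false \in w ++ v by rewrite wvE mem_cat mem_head orbT.
    by rewrite mem_cat orbC -mem_cat -E mem_nseq andbF.
  apply: (approx _ [:: nseq m.+1 true]) => // [e sze _|e eL]; first exact: allL.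
  apply: contraR => ne; have : false \in e.
    apply: contraR ne => /ones ->; rewrite szL // mem_seq1 //.
  case/splitPr=> v w; apply/belowP; exists v, (false :: w); split=> //.
have [t [szt Qt nbt belowL]] := some_rot_words_min hasQ.
have {}belowL e : size e = m.+1 -> below t e -> e \in L.
  by move=> sze /(belowL _ sze); apply: contraR; exact: some_rot_self.
exists t; split=> //.
pose P u := ~~ below t u && ~~ some_rot (pred1 t) u.
have rotP u : some_rot P u = P u.
  apply/idP/idP; last exact: some_rot_self.
  by case/some_rotP => v [w [->]]; rewrite /P below_catC some_rot_catC.
have notP X e : ~~ P e -> ~~ below t e -> e \in rotations t ++ X.
  by rewrite /P negb_and !negbK mem_cat => /orP[->//|/mem_rotations->].
have szR : size (rotations t) = m.+2 by rewrite size_mkseq szt.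
have [hasP'|noP] := boolP (has (some_rot P) (words m.+1)); last first.
  apply: (approx _ (rotations t ++ [::])) => // [e eL|]; last first.
    by rewrite cats0 szR; lia.
  apply: notP; apply: contra noP => Pe; apply/hasP; exists e.
    by rewrite mem_words szL.
  by rewrite rotP.
have [t' [szt' + nbt' belowP']] := some_rot_words_min hasP'.
rewrite rotP => /andP[nbtt' ntt'].
have {}belowP' e : size e = m.+1 -> below t' e -> ~~ P e.
  by move=> sze bte; rewrite -rotP; exact: belowP'.
have ltt' : lts t t'.
  have [||//|t't] := orP (@lts_total t t' _ _); first by rewrite szt.
    by apply: contra ntt' => /eqP<-; apply: some_rot_self => /=.
  by case/negP: nbtt'; exact: some_rot_self.
have [h0|h0] := boolP (head false t'); last first.
  have [||T [uT _ WT]] := greedy_fills_initial (@greedy_letter_greedy m)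
      (factor_greedy_letter0 m) _ (fun _ => negbTE h0).
  - by rewrite szt' leqnn.
  - by rewrite szt' subnn cats0.
  have leMT : M <= T.
    rewrite leqNgt; apply/negP => /ltnW leTM.
    case/some_rotP: Qt => v [w [tE /negP]]; apply.
    apply: (windows_subset leTM); rewrite WT /initial.
    rewrite size_cat addnC -size_cat -tE szt eqxx below_catC -tE.
    by apply/orP; left; exact: some_rot_self.
  apply: (approx _ (rotations t ++ entry_edges m t')) => // [e eL nbe|].
    have := windows_subset leMT eL; rewrite WT => /andP[/eqP sze /orP[be|ee]].
      exact: notP (belowP' _ sze be) nbe.
    by rewrite mem_cat ee orbT.
  by rewrite size_cat szR size_map size_iota szt'; lia.
apply: (approx _ (rotations t ++ [:: nseq m.+1 true])) => // [e eL nbe|]; last first.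
  by rewrite size_cat szR /=; lia.
have [Pe|nPe] := boolP (P e); last exact: notP.
rewrite mem_cat mem_seq1 -(szL e eL) -ones ?eqxx ?orbT //.
apply: contraL Pe => e0; apply: belowP'; first exact: szL.
case/splitPr: e0 => v w; apply/belowP; exists v, (false :: w); split=> //=.
by move: h0; case: (t') => //= -[].
Qed.

(** * Words without long runs of zeros *)

(** The maximal length of a run of zeros is [c]; [j] is what remains of it for
    the run at the start of the word, which may continue a run before it. *)
Fixpoint avoid (c j : nat) (w : seq bool) : bool :=
  match w with
  | [::] => true
  | true :: w' => avoid c c w'
  | false :: w' => (0 < j) && avoid c j.-1 w'
  end.

Definition avoiders (c j N : nat) : nat := count (avoid c j) (words N).

Lemma avoid_cat_true c j u v :
  avoid c j (u ++ true :: v) = avoid c j u && avoid c c v.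
Proof. by elim: u j => [|[] u IHu] j //=; rewrite IHu andbA. Qed.

Lemma avoid_nseq c j i : avoid c j (nseq i false) = (i <= j).
Proof. by elim: i j => [|i IHi] [|j] //=; rewrite IHi. Qed.

Lemma avoid_nseq_cat c j e : avoid c j (nseq j.+1 false ++ e) = false.
Proof. by elim: j => [|j IHj] //=. Qed.

Lemma avoid_weaken c i j w : i <= j -> avoid c i w -> avoid c j w.
Proof.
elim: w i j => [|[] w IHw] i j //= leij /andP[i_gt0 /(IHw _ j.-1)->]; lia.
Qed.

Lemma avoid_suffix c j v w : j <= c -> avoid c j (v ++ w) -> avoid c c w.
Proof.
elim: v j => [|[] v IHv] j /= lejc; first exact: avoid_weaken.
  exact: IHv.
by case/andP=> _; apply: IHv; lia.
Qed.

Lemma not_avoidP c j w : j <= c -> ~~ avoid c j w ->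
  exists e1 e2, w = e1 ++ e2 /\
    (prefix (nseq c.+1 false) e2 \/ e1 = [::] /\ prefix (nseq j.+1 false) e2).
Proof.
elim: w j => [|[] w IHw] //= j lejc.
  move=> /(IHw _ (leqnn c))[e1 [e2 [-> H]]]; exists (true :: e1), e2; split=> //.
  by left; case: H => [|[]].
case: j lejc => [|j] /= lejc.
  by exists [::], (false :: w); split=> //; right; split=> //=; rewrite prefix0s.
move=> /(IHw _ (ltnW lejc))[e1 [e2 [wE [H|[e1E H]]]]].
  by exists (false :: e1), e2; rewrite wE; split=> //; left.
exists [::], (false :: w); split=> //; right; split=> //=.
by rewrite wE e1E.
Qed.

Lemma not_avoid_run c w : ~~ avoid c c w ->
  exists e1 e2, w = e1 ++ nseq c.+1 false ++ e2.
Proof.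
case/(not_avoidP (leqnn c)) => e1 [e2 [-> H]].
have /prefixP[e3 ->] : prefix (nseq c.+1 false) e2 by case: H => [|[]].
by exists e1, e3.
Qed.

Lemma avoidersS c j N : avoiders c j N.+1 =
  (if j is j'.+1 then avoiders c j' N else 0) + avoiders c c N.
Proof.
rewrite /avoiders /= count_cat !count_map; congr addn.
case: j => [|j]; last exact: eq_count.
by rewrite (@eq_count _ _ pred0) ?count_pred0.
Qed.

Lemma avoiders0 c j : avoiders c j 0 = 1.
Proof. by []. Qed.

Lemma avoiders_le_pow c j N : avoiders c j N <= 2 ^ N.
Proof. by rewrite -size_words; exact: count_size. Qed.

Lemma avoiders_weaken c i j N : i <= j -> avoiders c i N <= avoiders c j N.
Proof. by move=> leij; apply: sub_count => w; exact: avoid_weaken. Qed.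

Lemma avoiders_double c j N : j <= c -> avoiders c j N.+1 <= 2 * avoiders c c N.
Proof.
case: j => [|j] ltjc; rewrite avoidersS; first lia.
have := @avoiders_weaken c j c N (ltnW ltjc); lia.
Qed.

Lemma avoiders_pow c d N : avoiders c c (N + d) <= 2 ^ d * avoiders c c N.
Proof.
elim: d => [|d IHd]; first by rewrite addn0 mul1n.
rewrite addnS expnS -mulnA.
by apply: leq_trans (avoiders_double _ (leqnn c)) _; rewrite leq_mul2l.
Qed.

(** The words that are lost when the allowance for the initial run drops from
    [j + 1] to [j] are [0^(j+1) 1 w'] with an arbitrary avoider [w']. *)
Lemma avoiders_initial_run c j N :
  avoiders c j.+1 (N + j + 2) = avoiders c j (N + j + 2) + avoiders c c N.
Proof.
elim: j N => [|j IHj] N.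
  by rewrite addn0 addn2 avoidersS (avoidersS c 0 N) (avoidersS c 0) addnC.
have -> : N + j.+1 + 2 = (N + j + 2).+1 by lia.
rewrite avoidersS IHj (avoidersS c j.+1); lia.
Qed.

(** An avoider followed by any letter avoids again, unless it ends in
    [1 0^(k+1)] and the letter is a [0]. *)
Lemma avoiders_rec k N :
  avoiders k.+1 k.+1 (N + k.+3) + avoiders k.+1 k.+1 N =
  2 * avoiders k.+1 k.+1 (N + k.+2).
Proof.
have := avoiders_initial_run k.+1 k N.
rewrite (_ : N + k + 2 = N + k.+2); last lia.
rewrite (addnS N k.+2) avoidersS; lia.
Qed.

(** The proportion of avoiders among the words of length [N] is at most about
    [2^(k+2) / N].  Indeed, by the recursion, each further letter reduces this
    proportion at least by the factor [1 - 2^-(k+2)]. *)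
Lemma avoiders_decay k y :
  avoiders k k (k.+1 + y) * y <= 2 ^ (k.+1 + y) * 2 ^ k.+2.
Proof.
set Q := 2 ^ k.+2; case: k @Q => [|k] Q.
  have a1 N : avoiders 0 0 N <= 1.
    by elim: N => [|N IHN]; rewrite ?avoiders0 // avoidersS add0n.
  apply: leq_trans (leq_mul (a1 _) (leqnn _)) _; rewrite mul1n.
  have := ltn_expl y (isT : 1 < 2); rewrite /Q expnD; nia.
elim: y => [|y IHy]; first by rewrite muln0.
set A := avoiders k.+1 k.+1 (k.+2 + y) in IHy.
set A' := avoiders k.+1 k.+1 (k.+2 + y.+1).
have rec : A' + avoiders k.+1 k.+1 y = 2 * A.
  rewrite /A /A' [k.+2 + y]addnC -avoiders_rec.
  by congr (avoiders _ _ _ + _); lia.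
have low : A <= 2 ^ k.+2 * avoiders k.+1 k.+1 y.
  by rewrite /A addnC; exact: avoiders_pow.
have QE : Q = 2 * 2 ^ k.+2 by rewrite /Q expnS.
have decay : 2 ^ k.+2 * A' <= (Q - 1) * A by nia.
rewrite addnS expnS; set B := 2 ^ (k.+2 + y) in IHy *.
have [leyQ|ltQy] := leqP y.+1 Q.
  have := avoiders_le_pow k.+1 k.+1 (k.+2 + y.+1).
  by rewrite -/A' addnS expnS -/B; nia.
have Q_gt0 : 0 < 2 ^ k.+2 by rewrite expn_gt0.
rewrite -(leq_pmul2l Q_gt0).
have h1 : 2 ^ k.+2 * A' * y.+1 <= (Q - 1) * A * y.+1 by rewrite leq_mul2r decay orbT.
have h2 : (Q - 1) * y.+1 <= Q * y by nia.
have h3 : (Q - 1) * A * y.+1 <= Q * (B * Q) by nia.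
have h4 : Q * (B * Q) = 2 ^ k.+2 * (2 * B * Q) by rewrite {1}QE -!mulnA mulnCA.
by rewrite -h4 mulnA; exact: leq_trans h1 h3.
Qed.

Lemma avoiders_growth k N :
  3 * avoiders k.+1 k.+1 N <= 2 * avoiders k.+1 k.+1 N.+1.
Proof.
rewrite avoidersS; suff : avoiders k.+1 k.+1 N <= 2 * avoiders k.+1 k N by lia.
case: N => // N; have := avoiders_double N (leqnn k.+1).
have : avoiders k.+1 k.+1 N <= avoiders k.+1 k N.+1 by rewrite avoidersS leq_addl.
lia.
Qed.

(** A geometric sum, by the growth rate [3/2]. *)
Lemma sum_avoiders k N :
  \sum_(i < N) avoiders k.+1 k.+1 i <= 2 * avoiders k.+1 k.+1 N.
Proof.
elim: N => [|N IHN]; first by rewrite big_ord0.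
rewrite big_ord_recr /=; apply: leq_trans (leq_add IHN (leqnn _)) _.
have := avoiders_growth k N; lia.
Qed.

(** Union bound: a forbidden run starts at one of [N] places with probability
    at most [2^-(c+1)] each, and at the beginning, where [c - j] zeros are
    taken as read, with probability [2^-(j+1)]. *)
Lemma avoiders_lower c j N : j <= c ->
  2 ^ N * 2 ^ c.+1 <= avoiders c j N * 2 ^ c.+1 + 2 ^ N * (2 ^ (c - j) + N).
Proof.
elim: N j => [|N IHN] j lejc; first by rewrite avoiders0 leq_addr.
rewrite avoidersS; have := IHN c (leqnn c); rewrite subnn expn0.
case: j lejc => [|j] lejc.
  by rewrite subn0 !expnS add0n; nia.
have := IHN j (ltnW lejc); rewrite (_ : c - j = (c - j.+1).+1); last lia.
rewrite !expnS; nia.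
Qed.

Lemma avoiders_half c N : N < 2 ^ c -> 2 ^ N <= 2 * avoiders c c N.
Proof.
move=> ltN; have := avoiders_lower N (leqnn c); rewrite subnn expn0 expnS.
have : 0 < 2 ^ N by rewrite expn_gt0.
have : 0 < 2 ^ c by rewrite expn_gt0.
nia.
Qed.

(** * Counting pivotal words *)

(** If the letter after [d] decides the comparison, then nothing before it
    does, so that [d] agrees with [t]. *)
Lemma lts_pivot d v t : lts (d ++ false :: v) t -> ~~ lts (d ++ true :: v) t ->
  d = take (size d) t /\ lts (false :: v) (drop (size d) t).
Proof.
elim: d t => [|a d IHd] [|b t] //=; have [-> H1 H2|_ -> //] := eqVneq a b.
by have [dE lv] := IHd _ H1 H2; split=> //; rewrite -dE.
Qed.

Lemma lts_zeros i v t : lts v (nseq i false ++ t) ->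
  exists v', v = nseq i false ++ v'.
Proof.
elim: i v => [|i IHi] v; first by exists v.
by case: v => [|[] v] //= /IHi[v' ->]; exists v'.
Qed.

Lemma below_run k t u v :
  below (nseq k false ++ true :: t) (u ++ nseq k.+1 false ++ v).
Proof.
apply/belowP; do 2!eexists; split; first by [].
apply/lts_splitP; exists (nseq k false), (v ++ u), t.
by rewrite -addn1 nseqD -!catA.
Qed.

(** Let [x0] have a rotation [d 0 v] below [t = 0^(k+1) 1...], and [x1] none
    below [t].  Then [d] is a prefix of [t]; and if it is shorter than [k + 1],
    then [v] starts with the remaining zeros of the run.  So [x] is determined
    by [|d|] and a word that avoids [0^(k+2)], as [x1] does. *)
Lemma pivots_le k m t : k.+1 <= m -> size t = m.+1 ->
    t = nseq k.+1 false ++ true :: drop k.+2 t ->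
  pivots m t <= (k + 3) * avoiders k.+1 k.+1 (m - k).
Proof.
move=> lekm szt tE.
pose W i := filter (avoid k.+1 k.+1) (words i).
pose s1 := [seq nseq (k - p) false ++ v ++ nseq p false |
             p <- iota 0 k.+1, v <- W (m - k)].
pose s2 := [seq v ++ take (m - i) t | i <- iota 0 (m - k), v <- W i].
have szW i : size (W i) = avoiders k.+1 k.+1 i by rewrite size_filter.
have size1 : size s1 = k.+1 * avoiders k.+1 k.+1 (m - k).
  by rewrite size_allpairs size_iota szW.
have size2 : size s2 <= 2 * avoiders k.+1 k.+1 (m - k).
  rewrite size_allpairs_dep; apply: leq_trans (sum_avoiders k _).
  rewrite sumnE big_map -[X in iota 0 X]subn0 big_mkord.
  by apply: leq_sum => i _; rewrite szW.
apply: (@leq_trans (size (s1 ++ s2))); last first.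
  by rewrite size_cat size1; lia.
rewrite /pivots -size_filter.
apply: uniq_leq_size; first by rewrite filter_uniq ?words_uniq.
move=> x; rewrite mem_filter mem_words => /andP[/andP[b0 nb1] /eqP szx].
have [v [d [xE lt0]]] : exists v d : seq bool, x = v ++ d /\ lts (d ++ false :: v) t.
  case/belowP: b0 => v [w []]; case/lastP: w => [|w b].
    by rewrite cats0 => <- /=; exists [::], x; rewrite cats1.
  rewrite -rcons_cat => /rcons_inj[-> <-]; rewrite cat_rcons.
  by exists v, w.
have nlt1 : ~~ lts (d ++ true :: v) t.
  apply: contra nb1 => lt1; apply/belowP; exists v, (rcons d true).
  by rewrite xE rcons_cat cat_rcons.
have [dE ltv] := lts_pivot lt0 nlt1.
have av e1 e2 e3 : v = e1 ++ e2 ++ e3 -> avoid k.+1 k.+1 e2.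
  move=> vE; apply/negPn/negP => /not_avoid_run[a [b e2E]]; case/negP: nb1.
  rewrite xE vE e2E tE -cats1 -!catA (catA e1 a); exact: below_run.
have szvd : size v + size d = m by rewrite -size_cat -xE.
rewrite mem_cat; apply/orP; have [ltdk|lekd] := ltnP (size d) k.+1.
  have dz : d = nseq (size d) false.
    by rewrite {1}dE tE take_cat size_nseq ltdk take_nseq // ltnW.
  move: ltv; rewrite tE drop_cat size_nseq ltdk drop_nseq subSn //=.
  case/lts_zeros => v' vE; left.
  have := av (nseq (k - size d) false) v' [::]; rewrite cats0 => /(_ vE) av'.
  apply/allpairsPdep; exists (size d), v'; split=> //.
  - by rewrite mem_iota.
  - rewrite mem_filter av' mem_words /=; apply/eqP.
    have := congr1 size vE; rewrite size_cat size_nseq; lia.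
  by rewrite -dz xE {1}vE -catA.
right; have := av [::] v [::]; rewrite cats0 => /(_ (erefl _)) av'.
apply/allpairsPdep; exists (size v), v; split=> //.
- rewrite mem_iota; lia.
- by rewrite mem_filter av' mem_words eqxx.
by rewrite xE {1}dE -szvd addKn.
Qed.

Lemma pivots_true m t : head false t -> pivots m t <= 1.
Proof.
case: t => [|[] t] // _; rewrite /pivots -size_filter.
apply: (@uniq_leq_size _ _ [:: nseq m true]).
  by rewrite filter_uniq ?words_uniq.
move=> x; rewrite mem_filter mem_words mem_seq1 => /andP[/andP[_ nb] /eqP<-].
apply/eqP/all_pred1P/allP => -[] // x0; case/negP: nb; case/splitPr: x0 => v w.
by rewrite -cats1 -catA; exact: (@below_run 0).
Qed.

Lemma pivots_zeros m i : pivots m (nseq i false) = 0.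
Proof.
apply/eqP; rewrite -leqn0 leqNgt -has_count; apply/hasP => -[x _ /andP[]].
case/belowP=> v [w [_ /lts_splitP[c [g [h [_ E]]]]]] _.
have : true \in nseq i false by rewrite E mem_cat mem_head orbT.
by rewrite mem_nseq andbF.
Qed.

Lemma zeros_split t : t = nseq (size t) false \/
  exists k, t = nseq k false ++ true :: drop k.+1 t.
Proof.
elim: t => [|[] t IHt] /=; [by left|by right; exists 0; rewrite /= drop0|].
by case: IHt => [E|[k E]]; [left|right; exists k.+1]; rewrite /= -E.
Qed.

(** The words [0^q 1 s 1 0^p] with [p + q = k] and [s] without a run of
    [k + 1] zeros are pivotal: with a [0] appended, and only so, they have a
    cyclic run of [k + 1] zeros. *)
Lemma pivots_ge k m : k.+2 <= m ->
  k.+1 * avoiders k k (m - k.+2) <= pivots m (rcons (nseq k false) true).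
Proof.
move=> lekm; set t := rcons _ _.
have tE : t = nseq k false ++ true :: [::] by rewrite /t -cats1.
pose W := filter (avoid k k) (words (m - k.+2)).
pose g p s := nseq (k - p) false ++ true :: s ++ true :: nseq p false.
pose s1 := [seq g p s | p <- iota 0 k.+1, s <- W].
have <- : size s1 = k.+1 * avoiders k k (m - k.+2).
  by rewrite size_allpairs size_iota size_filter.
rewrite /pivots -size_filter; apply: uniq_leq_size.
  apply: allpairs_uniq; rewrite ?iota_uniq ?filter_uniq ?words_uniq //.
  move=> _ _ /allpairsPdep[p [s [+ _ ->]]] /allpairsPdep[p' [s' [+ _ ->]]].
  rewrite !mem_iota => lep lep' /= gE.
  have pp' : p = p'.
    have := congr1 (index true) gE.
    rewrite !index_cat !mem_nseq !andbF !size_nseq /=; lia.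
  have ss' : size s = size s'.
    by have := congr1 size gE; rewrite pp' !size_cat /= !size_cat; lia.
  move: gE; rewrite pp' => /eqP; rewrite eqseq_cat // eqxx eqseq_cons eqxx /=.
  by rewrite eqseq_cat // => /andP[/eqP-> _].
move=> _ /allpairsPdep[p [s [+ + ->]]]; rewrite mem_iota !mem_filter !mem_words.
rewrite add0n ltnS leq0n => /= lepk /andP[avs /eqP szs].
have -> : size (g p s) == m.
  by rewrite !size_cat /= size_cat /= !size_nseq szs; apply/eqP; lia.
rewrite andbT; apply/andP; split.
  apply/belowP; exists (nseq (k - p) false ++ true :: s ++ [:: true]).
  exists (nseq p.+1 false); split.
    by rewrite /g -[p.+1]addn1 (nseqD p 1) -cats1 -!catA /= -!catA.
  apply/lts_splitP; exists (nseq k false), (true :: s ++ [:: true]), [::].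
  split=> //; rewrite catA -nseqD.
  rewrite -[RHS]/(nseq k false ++ nseq 1 false ++ true :: s ++ [:: true]).
  by rewrite [RHS]catA -nseqD; congr (nseq _ _ ++ _); lia.
apply/belowP => -[v [w [uE /lts_splitP[c [f [h [wvE cE]]]]]]].
have ck : c = nseq k false by exact: zeros_one_split cE.
have : avoid k k (w ++ v ++ w).
  apply: (avoid_suffix (leqnn k) (v := v)).
  have -> : v ++ w ++ v ++ w = rcons (g p s) true ++ rcons (g p s) true.
    by rewrite uE -!catA.
  rewrite /g -!cats1 -!catA /= -!catA /= !avoid_cat_true !avoid_nseq avs lepk.
  by rewrite leq_subr.
rewrite catA wvE ck -cat_rcons -cats1 -(nseqD k 1) addn1 -catA.
by rewrite avoid_nseq_cat.
Qed.

(** * The order of magnitude *)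

Lemma disc_ge m M : M <= 2 ^ m.+1 ->
  absz (word_sum m M) <= disc (lex_least_de_bruijn m.+1).
Proof.
rewrite lex_least_de_bruijnE /disc; case: M => [|M] ltM.
  by rewrite /word_sum big_geq.
have ltM' : M < size (greedy_word m) by rewrite size_factor.
exact: (leq_bigmax (Ordinal ltM')).
Qed.

Lemma disc_le m B : (forall M, M <= 2 ^ m.+1 -> absz (word_sum m M) <= B) ->
  disc (lex_least_de_bruijn m.+1) <= B.
Proof.
move=> leB; rewrite lex_least_de_bruijnE; apply/bigmax_leqP => -[M ltM] _ /=.
by apply: leB; rewrite size_factor in ltM.
Qed.

Lemma pow2_square n : 16 <= n -> 32 * (n * n) <= 2 ^ n.
Proof.
move=> len; rewrite -(subnKC len); elim: (n - 16) => [|d IHd].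
  by rewrite addn0; lia.
rewrite addnS expnS; nia.
Qed.

Lemma pow2_linear l : 4 <= l -> 4 * l <= 2 ^ l.
Proof.
move=> lel; rewrite -(subnKC lel); elim: (l - 4) => [|d IHd]; first by [].
rewrite addnS expnS; nia.
Qed.

(** If [t] begins with fewer than [l] zeros, [avoiders_decay] bounds the number
    of avoiders; otherwise the trivial bound by all words is good enough, since
    [(k + 3) / 2^k] decreases. *)
Lemma pivots_upper m t (l := trunc_log 2 m.+1) :
  16 <= m.+1 -> size t = m.+1 -> m.+1 * pivots m t <= 16 * (l * 2 ^ m.+1).
Proof.
move=> lem szt; set n := m.+1 in l lem szt *.
have /andP[leln ltnl] := trunc_log_bounds (isT : 1 < 2) (ltn0Sn m).
rewrite -/n -/l in leln ltnl.
have lel : 4 <= l by rewrite /l; apply: trunc_log_max.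
have [->|[[|k] tE]] := zeros_split t.
- by rewrite pivots_zeros muln0.
- have := @pivots_true m t; rewrite tE => /(_ isT) le1.
  have := ltn_expl n (isT : 1 < 2); nia.
have lekm : k.+1 <= m.
  by have := congr1 size tE; rewrite size_cat size_nseq szt /= -/n /n; lia.
apply: leq_trans (leq_mul (leqnn n) (pivots_le lekm szt tE)) _.
set a := avoiders _ _ _.
have [ltkl|lelk] := ltnP k.+1 l.
  have lin := pow2_linear lel.
  have := @avoiders_decay k.+1 (n - k.+1 - k.+2).
  rewrite (_ : k.+2 + (n - k.+1 - k.+2) = m - k); last by rewrite /n in leln *; lia.
  rewrite -/a -expnD (_ : m - k + k.+3 = n + 2); last by rewrite /n; lia.
  rewrite expnD => decay.
  have half : n <= 2 * (n - k.+1 - k.+2) by lia.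
  have an : a * n <= 8 * 2 ^ n by nia.
  nia.
have aP : a <= 2 ^ (m - k) := avoiders_le_pow _ _ _.
have powE : 2 ^ l * 2 ^ (m - k) * 2 ^ (k.+1 - l) = 2 ^ n.
  by rewrite -!expnD; congr (2 ^ _); rewrite /n; lia.
have kl : k + 3 <= (l + 2) * 2 ^ (k.+1 - l).
  have := ltn_expl (k.+1 - l) (isT : 1 < 2); nia.
rewrite expnS in ltnl.
have h1 : n * ((k + 3) * a) <= 2 * 2 ^ l * ((l + 2) * 2 ^ (k.+1 - l) * 2 ^ (m - k)).
  by apply: leq_mul; [lia | apply: leq_mul].
apply: leq_trans h1 _.
rewrite (_ : _ * _ = 2 * (l + 2) * 2 ^ n); last by rewrite -powE; lia.
nia.
Qed.

Lemma disc_upper m (l := trunc_log 2 m.+1) : 16 <= m.+1 ->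
  m.+1 * disc (lex_least_de_bruijn m.+1) <= 19 * (l * 2 ^ m.+1).
Proof.
move=> lem; have sq := pow2_square lem.
have l_gt0 : 0 < l by rewrite /l; apply: trunc_log_max => //; lia.
have leB M : M <= 2 ^ m.+1 -> m.+1 * absz (word_sum m M) <= 19 * (l * 2 ^ m.+1).
  move=> leM; have [t [szt _ approx]] := word_sum_pivots leM.
  have := pivots_upper lem szt; rewrite -/l.
  have : absz (word_sum m M) <= pivots m t + (2 * m.+1 + 1) by lia.
  nia.
rewrite mulnC -leq_divRL //; apply: disc_le => M leM.
by rewrite leq_divRL // mulnC leB.
Qed.

(** Here [2^k > n] for [k = l + 1], which is what [avoiders_half] needs, while
    [2^k <= 2n] keeps the number of pivotal words large. *)
Lemma disc_lower m (l := trunc_log 2 m.+1) : 16 <= m.+1 ->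
  l * 2 ^ m.+1 <= 32 * (m.+1 * disc (lex_least_de_bruijn m.+1)).
Proof.
move=> lem; have sq := pow2_square lem.
have /andP[leln ltnl] := trunc_log_bounds (isT : 1 < 2) (ltn0Sn m).
rewrite -/l in leln ltnl.
have lel : 4 <= l by rewrite /l; apply: trunc_log_max.
have lin := pow2_linear lel.
pose k := l.+1.
have lekm : k.+2 <= m by rewrite /k; lia.
have szp : size (rcons (nseq k false) true) = k.+1 by rewrite size_rcons size_nseq.
have [|M leM] := pivots_le_word_sum _ (@head_zeros_one k)
                   (zeros_one_not_below k (m.+1 - _)).
  by rewrite szp; lia.
have := disc_ge leM; set D := disc _ => leD lepiv.
have half : 2 ^ (m - k.+2) <= 2 * avoiders k k (m - k.+2).
  by apply: avoiders_half; apply: leq_ltn_trans ltnl; lia.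
have piv := pivots_ge lekm; set P := pivots _ _ in piv lepiv.
have powE : 2 ^ (m - k.+2) * (16 * 2 ^ l) = 2 ^ m.+1.
  by rewrite -(expnD 2 4 l) -expnD; congr (2 ^ _); rewrite /k; lia.
have h1 : k.+1 * 2 ^ (m - k.+2) <= 2 * P by nia.
have h2 : k.+1 * 2 ^ m.+1 <= 2 * P * (16 * 2 ^ l).
  by rewrite -powE mulnA leq_mul2r h1 orbT.
have h3 : 2 * P * (16 * 2 ^ l) <= 32 * (m.+1 * P) by nia.
have h4 : 32 * (m.+1 * P) <= 32 * (m.+1 * D) + 2 ^ m.+1 by nia.
rewrite /k in h2; nia.
Qed.

Local Open Scope ring_scope.

Lemma ln_trunc_log (R : realType) n (l := trunc_log 2 n) : (1 < n)%N ->
  l%:R * ln 2 <= ln n%:R :> R /\ ln n%:R <= 2 * l%:R * ln 2 :> R.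
Proof.
move=> n_gt1; have n_gt0 := ltnW n_gt1.
have /andP[leln ltnl] := trunc_log_bounds (isT : (1 < 2)%N) n_gt0.
have l_gt0 : (0 < l)%N by exact: trunc_log_max.
have two_gt0 : (0 : R) < 2 by [].
have lnX i : ln (2 ^+ i) = i%:R * ln 2 :> R by rewrite lnXn // mulr_natl.
have pos i : (0 < i)%N -> i%:R \is Num.pos (R := R).
  by move=> i_gt0; rewrite posrE ltr0n.
split; first by rewrite -lnX -natrX ler_ln ?pos ?expn_gt0 // ler_nat.
apply: (@le_trans _ _ (l.+1%:R * ln 2)).
  by rewrite -lnX -natrX ler_ln ?pos ?expn_gt0 // ler_nat ltnW.
rewrite ler_wpM2r ?ln_ge0 ?ler1n // -natrM ler_nat; lia.
Qed.

Theorem theorem1 (R : realType) :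
  exists (c C : R) (n0 : nat),
    [/\ 0 < c, 0 < C &
      forall n : nat, (n0 <= n)%N ->
        c * (2 ^+ n * ln n%:R / n%:R) <= (disc (lex_least_de_bruijn n))%:R
        <= C * (2 ^+ n * ln n%:R / n%:R)].
Proof.
have ln2 : 0 < ln 2 :> R by rewrite ln_gt0 // ltr1n.
exists (64 * ln 2)^-1, (19 / ln 2), 16%N; split.
- by rewrite invr_gt0 mulr_gt0.
- by rewrite divr_gt0.
case=> // m lem; set n := m.+1 in lem *; set l := trunc_log 2 n.
have [] := @ln_trunc_log R n; first by exact: leq_trans lem.
rewrite -/l; set L := ln n%:R => leL Lle.
have := disc_upper lem; have := disc_lower lem; rewrite -/n -/l.
set D := disc _; rewrite -(ler_nat R) !natrM natrX => low.
rewrite -(ler_nat R) !natrM natrX => up.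
have n_gt0 : 0 < n%:R :> R by rewrite ltr0n.
have p_gt0 : 0 < 2 ^+ n :> R by rewrite exprn_gt0.
set N := n%:R in low up n_gt0 *; set P := 2 ^+ n in low up p_gt0 *.
set d := D%:R in low up *; set b := ln 2 in ln2 leL Lle *.
apply/andP; split.
  have -> : (64 * b)^-1 * (P * L / N) = P * L / (64 * b * N).
    by field; rewrite !gt_eqF.
  rewrite ler_pdivrMr ?mulr_gt0 //.
  have := ler_wpM2l (ltW p_gt0) Lle; have := ler_wpM2l (ltW ln2) low; lra.
have -> : 19 / b * (P * L / N) = 19 * P * L / (b * N).
  by field; rewrite !gt_eqF.
rewrite ler_pdivlMr ?mulr_gt0 //.
have := ler_wpM2l (ltW p_gt0) leL; have := ler_wpM2l (ltW ln2) up; lra.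
Qed.
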